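(* There exists a stationary random vector field $v$ on $\mathbb{Z}^2$ such that, almost surely, $(\operatorname{div} v)_x = 1$ for every vertex $x \in \mathbb{Z}^2$.
   Context: The lattice $\mathbb{Z}^2$ is treated as an infinite graph: vertices are the points of $\mathbb{Z}^2$, and two vertices are joined by an edge iff they are at Euclidean distance $1$ (so each vertex has four neighbours). A vector field on this graph is a real-valued function $v$ on oriented edges, $(x,x') \mapsto v_{x,x'}$, such that its sum over the two orientations of an edge vanishes: $v_{x',x} = -v_{x,x'}$. The divergence of $v$ is the real-valued function on vertices $(\operatorname{div} v)_x = \sum_{x'} v_{x,x'}$, the sum being over the four neighbours $x'$ of $x$ (i.e. over outgoing edges). A random vector field is a random element of the space of vector fields (with the product $\sigma$-algebra). It is called stationary if it is shift-invariant in distribution: for every $z \in \mathbb{Z}^2$ the random field $(v_{x+z,x'+z})_{(x,x')}$ has the same distribution as $(v_{x,x'})_{(x,x')}$. *)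

(* Defs.v *)
From HB Require Import structures.
From mathcomp Require Import all_boot all_order all_algebra.
From mathcomp Require Import all_classical all_reals all_analysis.
From mathcomp Require Import ring zify.

Set Implicit Arguments.
Unset Strict Implicit.
Unset Printing Implicit Defensive.

Import Order.TTheory GRing.Theory Num.Theory.

Local Open Scope classical_set_scope.
Local Open Scope ring_scope.

Notation Z2 := (int * int)%type.

(* Squared Euclidean distance, so that adjacency is a boolean relation on
   integer points; [adjP] relates it to the distance itself. *)
Definition sqdist (x y : Z2) : int := (x.1 - y.1) ^+ 2 + (x.2 - y.2) ^+ 2.

Definition adj (x y : Z2) : bool := sqdist x y == 1.

Lemma adjP (R : rcfType) (x y : Z2) :
  reflect (Num.sqrt ((x.1%:~R - y.1%:~R) ^+ 2 + (x.2%:~R - y.2%:~R) ^+ 2)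
             = 1 :> R)
          (adj x y).
Proof.
rewrite -!rmorphB -!rmorphXn -rmorphD -/(sqdist x y) /adj.
have s0 : 0 <= sqdist x y by rewrite addr_ge0 ?sqr_ge0.
apply: (iffP eqP) => [->|h]; first by rewrite sqrtr1.
apply/eqP; rewrite -(eqr_int R) -[X in X == _]sqr_sqrtr ?ler0z//.
by rewrite h expr1n.
Qed.

Lemma adj_sym x y : adj x y = adj y x.
Proof.
by rewrite /adj /sqdist -[x.1 - y.1]opprB -[x.2 - y.2]opprB !sqrrN.
Qed.

Lemma adj_shift z x y : adj (x + z) (y + z) = adj x y.
Proof.
by case: x y z => [a b] [c d] [e f]; rewrite /adj /sqdist /=;
  congr (_ ^+ 2 + _ ^+ 2 == 1); ring.
Qed.

Definition oedge : Type := {e : Z2 * Z2 | adj e.1 e.2}.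

Definition tail (e : oedge) : Z2 := (sval e).1.
Definition head (e : oedge) : Z2 := (sval e).2.

Definition mkedge (x y : Z2) (xy : adj x y) : oedge :=
  exist (fun e : Z2 * Z2 => adj e.1 e.2) (x, y) xy.

Definition erev (e : oedge) : oedge :=
  mkedge (etrans (adj_sym (head e) (tail e)) (svalP e)).

Definition eshift (z : Z2) (e : oedge) : oedge :=
  mkedge (etrans (adj_shift z (tail e) (head e)) (svalP e)).

Lemma eshift_rev z e : eshift z (erev e) = erev (eshift z e).
Proof. exact: val_inj. Qed.

Record vfield (R : realType) := VField {
  vfun :> oedge -> R ;
  vfun_rev : forall e, vfun (erev e) = - vfun e }.

Definition vfield0 (R : realType) : vfield R :=
  @VField R (fun=> 0) (fun=> esym (oppr0 R)).

HB.instance Definition _ (R : realType) := gen_eqMixin (vfield R).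
HB.instance Definition _ (R : realType) := gen_choiceMixin (vfield R).
HB.instance Definition _ (R : realType) := isPointed.Build (vfield R) (vfield0 R).

(* The trace on vector fields of the product sigma-algebra of R^oedge. *)
Definition cylinders (R : realType) : set (set (vfield R)) :=
  \bigcup_(e in [set: oedge])
    preimage_set_system [set: vfield R] (fun v => v e) (@measurable _ R).

Definition vfields (R : realType) := g_sigma_algebraType (@cylinders R).

Definition div (R : realType) (v : vfield R) (x : Z2) : R :=
  \sum_(e \in [set e : oedge | tail e = x]) v e.

Lemma adj_step (x s : Z2) : `|s.1| + `|s.2| = 1 -> adj x (x + s).
Proof.
by case: x s => [a b] [c d]; rewrite /adj /sqdist /= => h; apply/eqP; nia.
Qed.

Lemma edgeE x y z t xy zt :
  (@mkedge x y xy == @mkedge z t zt) = ((x, y) == (z, t)).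
Proof. by rewrite -val_eqE. Qed.

Lemma divE (R : realType) (v : vfield R) (x : Z2) :
  div v x = v (mkedge (@adj_step x (1, 0) erefl))
          + v (mkedge (@adj_step x (-1, 0) erefl))
          + v (mkedge (@adj_step x (0, 1) erefl))
          + v (mkedge (@adj_step x (0, -1) erefl)).
Proof.
pose r := [:: mkedge (@adj_step x (1, 0) erefl);
  mkedge (@adj_step x (-1, 0) erefl);
  mkedge (@adj_step x (0, 1) erefl);
  mkedge (@adj_step x (0, -1) erefl)].
have ur : uniq r.
  rewrite /r; clear r; case: x => [a b].
  by rewrite !cons_uniq !in_cons !in_nil !edgeE !xpair_eqE /=; lia.
rewrite /div (_ : [set e | _] = [set` r]).
  rewrite -fsbig_seq// /r 4!big_cons big_nil.
  by rewrite -!(@addrA R); do 3! congr (_ + _); exact: addr0.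
apply/seteqP; split=> [[[y z] yz]|e] /=.
  rewrite /tail /= => ?; subst y.
  rewrite !in_cons in_nil !edgeE !xpair_eqE !eqxx /=.
  move: yz; rewrite /adj /sqdist; clear r ur; case: x z => [a b] [c d] /=.
  by rewrite !xpair_eqE /=; nia.
by rewrite !inE => /or4P[] /eqP ->.
Qed.

Definition vshift (R : realType) (z : Z2) (v : vfields R) : vfields R :=
  @VField R (fun e => v (eshift z e))
    (fun e => etrans (congr1 v (eshift_rev z e)) (vfun_rev v (eshift z e))).

Lemma measurable_vshift (R : realType) (z : Z2) :
  measurable_fun [set: vfields R] (@vshift R z).
Proof.
apply: (@measurability _ _ _ (vfields R) _ _ (@cylinders R)) => //.
move=> _ [_ [e _ [B mB <-]] <-]; apply: sub_sigma_algebra.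
by exists (eshift z e) => //; exists B => //; rewrite !setTI.
Qed.

HB.instance Definition _ (R : realType) (z : Z2) :=
  isMeasurableFun.Build _ _ _ _ (@vshift R z) (@measurable_vshift R z).

Definition stationary d (Omega : measurableType d) (R : realType)
    (P : probability Omega R) (v : {RV P >-> vfields R}) : Prop :=
  forall (z : Z2) (A : set (vfields R)), measurable A ->
    distribution P (@vshift R z \o v : {mfun Omega >-> vfields R}) A =
    distribution P v A.
Arguments stationary {d Omega R} P v.

(* Main.v *)
From HB Require Import structures.
Require Import Defs.
From mathcomp Require Import all_boot all_order all_algebra.
From mathcomp Require Import all_classical all_reals all_analysis.
From mathcomp Require Import measurable_realfun.
From mathcomp Require Import ring lra zify.

(** A stationary field whose values are integrable has divergence of mean zero,
so the field has to be heavy-tailed: each vertex produces one unit of mass,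
which is carried along the edges through a random hierarchy of larger and larger
squares, and escapes to infinity.

Partition the plane, for each [n], into squares of side [2 ^ n], each partition
refining the next one, and suppose that the mass of every square of side
[2 ^ n] (that is [4 ^ n]) sits at its lower left corner. In a square of side
[2 ^ n.+1], the mass of the two right subsquares is sent west along their
bottom rows to the left column, and then the upper half is sent south along
this column; now everything sits at the lower left corner of the big square.
The divergence of this [n]-th flow is [4 ^ n] at the corners of side [2 ^ n]
minus [4 ^ n.+1] at the corners of side [2 ^ n.+1] ([level_div]), so
the sum over all [n] telescopes to 1 at every vertex near which only finitely
many of these flows are nonzero.

A nested system of such partitions is a pair [p] of 2-adic integers: the vertex
[x] is a corner of side [2 ^ n] when [2 ^ n] divides both coordinates of
[p + x]. The flow out of [x] is a function of [p + x], so shifting the field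
amounts to translating [p] ([vshift_current]); and a Haar-random [p] has a law
that is invariant under translations ([haar2_translate]). This gives
stationarity. Almost surely neither coordinate of [p] is an ordinary integer
([ae_not_integer]); then no coordinate of [p + x] vanishes, only
finitely many levels use any given edge, and the telescoping argument applies
([div_current]).

Haar measure on the 2-adic integers is obtained from Lebesgue measure on
[[0, 1[] by reading the binary digits of a real number as 2-adic digits;
its translation invariance follows from uniqueness of measures, since each
residue class modulo [2 ^ n] has mass [2 ^- n] ([haar_residue_class]). *)

Set Implicit Arguments.
Unset Strict Implicit.
Unset Printing Implicit Defensive.

Import Order.TTheory GRing.Theory Num.Theory.

Local Open Scope classical_set_scope.
Local Open Scope ring_scope.

(** * One level of the flow *)

Local Notation pow2 n := ((2 : int) ^+ n).

Lemma pow2_gt0 n : 0 < pow2 n.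
Proof. exact: exprn_gt0. Qed.

Lemma pow2_neq0 n : pow2 n != 0.
Proof. exact: expf_neq0. Qed.

Lemma modz_pow2_bounds n (a : int) : 0 <= (a %% pow2 n)%Z < pow2 n.
Proof. by rewrite modz_ge0 ?pow2_neq0// ltz_pmod ?pow2_gt0. Qed.

Lemma modz_pow2 m n (a : int) : (m <= n)%N ->
  ((a %% pow2 n)%Z %% pow2 m)%Z = (a %% pow2 m)%Z.
Proof.
by move=> mn; rewrite [in RHS](divz_eq a (pow2 n)) -(subnK mn) exprD mulrA modzMDl.
Qed.

Lemma dvdz_pow2_congr m n a b : (m <= n)%N -> (a = b %[mod pow2 n])%Z ->
  (pow2 m %| a)%Z = (pow2 m %| b)%Z.
Proof.
move=> mn ab; rewrite !(sameP dvdz_mod0P eqP).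
by rewrite -(modz_pow2 a mn) ab modz_pow2.
Qed.

(** The edge from [a] to [a - 1] lies on the way from the middle [2 ^ n] of an
interval of length [2 ^ n.+1] to its left end. *)
Definition in_half n (a : int) : bool := ((a - 1) %% pow2 n.+1)%Z < pow2 n.

Lemma half_congr n a b : (a = b %[mod pow2 n.+1])%Z -> in_half n a = in_half n b.
Proof. by move=> ab; rewrite /in_half -modzDml ab modzDml. Qed.

(** A unit flow from the middles of the intervals to their left ends has
divergence 1 at the middles and -1 at the left ends; the multiples of [2 ^ n]
are the middles and the left ends. *)
Lemma half_step n (a : int) :
  (in_half n a + (pow2 n.+1 %| a)%Z.*2 = in_half n (a + 1) + (pow2 n %| a)%Z)%N.
Proof.
rewrite /in_half addrK exprS; have := pow2_gt0 n; move: (pow2 n) => r r0.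
have tE := divz_eq a (2 * r); have := @modz_ge0 a (2 * r) ltac:(lia).
have := @ltz_pmod a (2 * r) ltac:(lia); move: tE.
move: (a %/ _)%Z (a %% _)%Z => q t -> t2r t0.
rewrite -addrA !modzMDl.
have -> : (2 * r %| q * (2 * r) + t)%Z = (t == 0).
  by rewrite (sameP dvdz_mod0P eqP) modzMDl modz_small ?t0.
have -> : (r %| q * (2 * r) + t)%Z = (t == 0) || (t == r).
  rewrite mulrA (sameP dvdz_mod0P eqP) modzMDl.
  case: (ltP t r) => tr; first by rewrite modz_small; lia.
  by rewrite (_ : t = 1 * r + (t - r)) ?modzMDl ?modz_small; lia.
have [->|tn0] := eqVneq t 0.
  (* Left of a multiple of [2 * r], the residue wraps around to [2 * r - 1]. *)
  by rewrite sub0r (_ : - 1 = (-1) * (2 * r) + (2 * r - 1)) ?modzMDl ?modz_small; lia.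
by rewrite modz_small; lia.
Qed.

Section Flow.
Variable R : realType.
Implicit Types (n : nat) (a : Z2).

Definition corner n a : bool := (pow2 n %| a.1)%Z && (pow2 n %| a.2)%Z.

(** Flow of the [n]-th level from [a] to its west neighbour. *)
Definition west n a : R := 4 ^+ n *+ (in_half n a.1 && (pow2 n %| a.2)%Z).

(** Flow of the [n]-th level from [a] to its south neighbour; the factor 2 is
there because the bottom row of the upper half has already merged two squares. *)
Definition south n a : R :=
  (2 * 4 ^+ n) *+ ((pow2 n.+1 %| a.1)%Z && in_half n a.2).

Lemma west_ge0 n a : 0 <= west n a.
Proof. by rewrite mulrn_wge0// exprn_ge0. Qed.

Lemma south_ge0 n a : 0 <= south n a.
Proof. by rewrite mulrn_wge0// mulr_ge0// exprn_ge0. Qed.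

(** The [n]-th level collects the corners of side [2 ^ n] into those of side
[2 ^ n.+1]. By [half_step] the westward part contributes
[4 ^ n * (X - 2 X') * Y] and the southward part [2 * 4 ^ n * X' * (Y - 2 Y')],
where [X], [Y] (resp. [X'], [Y']) are the indicators of the multiples of
[2 ^ n] (resp. [2 ^ n.+1]) in the two coordinates. *)
Lemma level_div n a :
  west n a - west n (a + (1, 0)) + (south n a - south n (a + (0, 1))) =
  4 ^+ n *+ corner n a - 4 ^+ n.+1 *+ corner n.+1 a.
Proof.
case: a => x y; rewrite /west /south /corner /= !addr0.
have := half_step n x; have := half_step n y.
move: (in_half n x) (in_half n (x + 1)) (in_half n y) (in_half n (y + 1)).
move: (pow2 n.+1 %| x)%Z (pow2 n %| x)%Z (pow2 n.+1 %| y)%Z (pow2 n %| y)%Z.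
case=> [] [] [] [] [] [] [] [] //= _ _;
  rewrite ?mulr1n ?mulr0n ?exprS; ring.
Qed.

(** The [n]-th level only sees the residues modulo [2 ^ n.+1], hence makes sense
at a point with 2-adic coordinates. *)
Definition periodic (phi : nat -> Z2 -> R) := forall n a b,
  (a.1 = b.1 %[mod pow2 n.+1])%Z -> (a.2 = b.2 %[mod pow2 n.+1])%Z ->
  phi n a = phi n b.

Lemma west_periodic : periodic west.
Proof.
by move=> n a b /half_congr ab1 /(dvdz_pow2_congr (leqnSn n)) ab2; rewrite /west ab1 ab2.
Qed.

Lemma south_periodic : periodic south.
Proof.
by move=> n a b /(dvdz_pow2_congr (leqnn _)) ab1 /half_congr ab2; rewrite /south ab1 ab2.
Qed.

End Flow.

(** * The measurable space of 2-adic integers *)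

(** The inverse limit of the rings of integers modulo [2 ^ n], with residues
represented in [[0, 2 ^ n[]: the single compatibility condition also forces
each residue to be reduced. *)
Record adic := Adic {
  residue :> nat -> int ;
  residue_step : forall n, residue n = (residue n.+1 %% pow2 n)%Z }.

Lemma residue_mod (a : adic) n : (a n %% pow2 n)%Z = a n.
Proof. by rewrite residue_step modz_mod. Qed.

Lemma residue_le (a : adic) m n : (m <= n)%N -> a m = (a n %% pow2 m)%Z.
Proof.
elim: n => [|n IHn]; first by rewrite leqn0 => /eqP ->; rewrite residue_mod.
rewrite leq_eqVlt => /predU1P[->|mn]; first by rewrite residue_mod.
by rewrite IHn// (residue_step a n) modz_pow2.
Qed.

Definition adic0 : adic := @Adic (fun=> 0) (fun n => esym (mod0z (pow2 n))).

HB.instance Definition _ := gen_eqMixin adic.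
HB.instance Definition _ := gen_choiceMixin adic.
HB.instance Definition _ := isPointed.Build adic adic0.

Lemma dvdz_residueS (a : adic) n y :
  (pow2 n %| a n.+1 + y)%Z = (pow2 n %| a n + y)%Z.
Proof.
by apply: (dvdz_pow2_congr (leqnn n)); rewrite (residue_step a n) modzDml.
Qed.

Lemma dvdz_residue_le (a : adic) y m n : (m <= n)%N ->
  (pow2 n %| a n + y)%Z -> (pow2 m %| a m + y)%Z.
Proof.
move=> mn /(dvdz_trans (dvdz_exp2l 2 mn)).
by rewrite (residue_le a mn) => /dvdz_mod0P h; apply/dvdz_mod0P; rewrite modzDml.
Qed.

(** [a] is the image of the integer [- z]; with this sign the divisibilities are
those that decide which flows pass through the vertices of coordinate [z]. *)
Definition is_integer (a : adic) : Prop :=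
  exists z : int, forall n, (pow2 n %| a n + z)%Z.

(** The divisibilities get stronger as [n] grows, so one failure suffices. *)
Lemma not_integer_eventually (a : adic) y : ~ is_integer a ->
  exists N, forall n, (N <= n)%N -> ~~ (pow2 n %| a n + y)%Z.
Proof.
move=> na; apply: contrapT => /forallNP h; apply: na; exists y => n.
apply/negPn/negP => hn; apply: (h n) => m nm.
by apply: contra hn; exact: dvdz_residue_le.
Qed.

Definition residue_class n (j : int) : set adic := [set a | a n = j].

Definition residue_classes : set (set adic) := [set A | exists n j, A = residue_class n j].

Definition adics := g_sigma_algebraType residue_classes.

(** Two residue classes are nested or disjoint; the empty set is the class of a
residue that is out of range. *)
Lemma residue_classes_setI_closed : setI_closed residue_classes.
Proof.
have step m n i j : (m <= n)%N -> residue_classes (residue_class m i `&` residue_class n j).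
  move=> mn; have [ij|ij] := eqVneq (j %% pow2 m)%Z i.
    exists n, j; apply/seteqP; split=> [a []//|a /= anj].
    by split=> //; rewrite /residue_class /= (residue_le a mn) anj.
  exists 0%N, 1; apply/seteqP; split=> [a [/= ami anj]|a /=].
    by move: ij; rewrite -anj -(residue_le a mn) ami eqxx.
  by rewrite /residue_class /= residue_step expr0 modz1.
move=> A B [m [i ->]] [n [j ->]].
by case/orP: (leq_total m n) => ?; [|rewrite setIC]; exact: step.
Qed.

Lemma residue_class_measurable n j : measurable (residue_class n j : set adics).
Proof. by apply: sub_sigma_algebra; exists n, j. Qed.

Fact translate_step z (a : adic) n :
  ((a n + z) %% pow2 n)%Z = (((a n.+1 + z) %% pow2 n.+1)%Z %% pow2 n)%Z.
Proof. by rewrite modz_pow2// residue_step modzDml. Qed.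

Definition translate (z : int) (a : adics) : adics :=
  @Adic _ (translate_step z a).

Lemma translate_residue_class z n j :
  (translate z @^-1` residue_class n j : set adics) =
  if (0 <= j < pow2 n) then residue_class n ((j - z) %% pow2 n)%Z else set0.
Proof.
apply/seteqP; split=> [a|].
  rewrite /residue_class /= => <-; rewrite modz_pow2_bounds /=.
  by rewrite modzDml addrK residue_mod.
case: ifPn => [jn a|_ a []]; rewrite /residue_class /= => ->.
by rewrite modzDml subrK modz_small.
Qed.

Lemma measurable_translate z : measurable_fun [set: adics] (translate z).
Proof.
apply: (@measurability _ _ _ adics _ _ residue_classes) => //.
move=> _ [_ [n [j ->]] <-]; rewrite setTI translate_residue_class.
by case: ifP => // _; exact: residue_class_measurable.
Qed.

HB.instance Definition _ z :=
  isMeasurableFun.Build _ _ _ _ (translate z) (measurable_translate z).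

Lemma residue_class_set0 n j : ~~ (0 <= j < pow2 n) -> residue_class n j = set0.
Proof.
move=> jn; apply/seteqP; split=> [a /= anj|//]; move: jn.
by rewrite -anj -residue_mod modz_pow2_bounds.
Qed.

Lemma residue_class0 : residue_class 0 0 = setT.
Proof. by apply/seteqP; split=> // a _; rewrite /residue_class /= -residue_mod expr0 modz1. Qed.

(** * Haar measure on the 2-adic integers *)

Lemma measurable_countable_preimage d (T : measurableType d) (U : countType)
    (f : T -> U) (B : set U) :
  (forall u, measurable (f @^-1` [set u])) -> measurable (f @^-1` B).
Proof.
move=> mf.
rewrite (_ : f @^-1` B = \bigcup_u (if u \in B then f @^-1` [set u] else set0)).
  apply: countable_bigcupT_measurable => [|u]; first exact: countableP.
  by case: ifP.
apply/seteqP; split=> [t Bt|t [u _]].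
  by exists (f t) => //; rewrite mem_set.
by case: ifPn => // /set_mem Bu /= ->.
Qed.

Fixpoint bitrev n (m : int) : int :=
  if n is n'.+1 then bitrev n' (m %/ 2)%Z + (m %% 2)%Z * pow2 n' else 0.

Lemma bitrev_bounds n m : 0 <= bitrev n m < pow2 n.
Proof.
elim: n m => //= n IHn m; have := IHn (m %/ 2)%Z.
by have := @modz_ge0 m 2 isT; have := @ltz_pmod m 2 isT; rewrite exprS; nia.
Qed.

Lemma bitrev_step n m : bitrev n (m %/ 2)%Z = (bitrev n.+1 m %% pow2 n)%Z.
Proof. by rewrite /= addrC modzMDl modz_small// bitrev_bounds. Qed.

(** Stated with a unique preimage rather than injectivity and surjectivity, as
this is what identifies the reals whose digits give the residue [j]. *)
Lemma bitrev_bij n j : 0 <= j < pow2 n -> exists2 m, 0 <= m < pow2 n &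
  forall m', 0 <= m' < pow2 n -> bitrev n m' = j <-> m' = m.
Proof.
elim: n j => [|n IHn] j jn.
  by exists 0 => //= m'; rewrite expr0 in jn *; lia.
have [|m mn mP] := IHn (j %% pow2 n)%Z; first exact: modz_pow2_bounds.
have jE := divz_eq j (pow2 n); have /andP[r0 rn] := modz_pow2_bounds n j.
have q02 : 0 <= (j %/ pow2 n)%Z < 2.
  move: jn; rewrite {1 2}jE exprS; move: rn r0; move: (_ %/ _)%Z (_ %% _)%Z => q t.
  by nia.
exists (2 * m + (j %/ pow2 n)%Z); first by rewrite exprS; nia.
move=> m' m'n /=.
have m'E := divz_eq m' 2.
have s0 := @modz_ge0 m' 2 isT; have s2 := @ltz_pmod m' 2 isT.
have /mP IH : 0 <= (m' %/ 2)%Z < pow2 n by rewrite exprS in m'n; nia.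
have /andP[b0 bn] := bitrev_bounds n (m' %/ 2)%Z.
split=> [bj|->].
  have sE : (m' %% 2)%Z = (j %/ pow2 n)%Z.
    by rewrite -bj addrC divzMDl ?pow2_neq0// divz_small ?addr0// abszE ger0_norm ?b0// exprn_ge0.
  rewrite m'E sE; congr (_ + _); rewrite mulrC; congr (_ * _).
  by apply/IH; rewrite -bj addrC modzMDl modz_small// b0.
have -> : ((2 * m + (j %/ pow2 n)%Z) %% 2)%Z = (j %/ pow2 n)%Z.
  by rewrite mulrC modzMDl modz_small.
have e : ((2 * m + (j %/ pow2 n)%Z) %/ 2)%Z = m.
  by rewrite mulrC divzMDl// divz_small ?addr0//; lia.
by rewrite e addrC [RHS]jE; congr (_ + _); apply/(mP m).
Qed.

Section Haar.
Variable R : realType.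

Lemma floor_half n (x : R) :
  Num.floor (2 ^+ n * x) = (Num.floor (2 ^+ n.+1 * x) %/ 2)%Z.
Proof.
apply: floor_def.
have /andP[] := floor_itv (2 ^+ n.+1 * x).
rewrite exprS -mulrA; move: (_ * x) (Num.floor _) => y m.
rewrite {1 2}(divz_eq m 2); have := @modz_ge0 m 2 isT; have := @ltz_pmod m 2 isT.
move: (_ %/ _)%Z (_ %% _)%Z => q t t2 t0.
have {t2}t1 : t <= 1 by lia.
rewrite -(@ler_int R) in t1; rewrite -(@ler_int R) in t0.
rewrite !(rmorphD, rmorphM) /=; lra.
Qed.

Fact digits_step (x : R) n :
  bitrev n (Num.floor (2 ^+ n * x)) =
  (bitrev n.+1 (Num.floor (2 ^+ n.+1 * x)) %% pow2 n)%Z.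
Proof. by rewrite floor_half bitrev_step. Qed.

(** The [k]-th binary digit of [x] after the point becomes the digit of weight
[2 ^ k.-1]: dropping the last digits of [floor (2 ^ n * x)] has to drop the
high-order digits of a residue modulo [2 ^ n], hence the reversal. The domain
is the copy of the reals that carries Lebesgue measure. *)
Definition digits (x : measurableTypeR R) : adics := @Adic _ (digits_step x).

Lemma floor_preimage n m : (fun x : R => Num.floor (2 ^+ n * x)) @^-1` [set m] =
  `[m%:~R / 2 ^+ n, (m + 1)%:~R / 2 ^+ n[%classic.
Proof.
apply/seteqP; split => x /=; rewrite in_itv /= ler_pdivrMr ?ltr_pdivlMr ?exprn_gt0// mulrC.
  by move=> <-; exact: floor_itv.
exact: floor_def.
Qed.

Lemma measurable_digits : measurable_fun [set: measurableTypeR R] digits.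
Proof.
apply: (@measurability _ _ _ adics _ _ residue_classes) => //.
move=> _ [_ [n [j ->]] <-]; rewrite setTI.
apply: (@measurable_countable_preimage _ (measurableTypeR R) _
  (fun x => Num.floor (2 ^+ n * x)) [set m | bitrev n m = j]) => m.
by rewrite floor_preimage; exact: measurable_itv.
Qed.

HB.instance Definition _ := isMeasurableFun.Build _ _ _ _ digits measurable_digits.

Definition lebesgue_unit :=
  mrestr (@lebesgue_measure R) (measurable_itv `[(0 : R), 1[).

HB.instance Definition _ := Measure.on lebesgue_unit.

Fact lebesgue_unitT : lebesgue_unit [set: R] = 1%:E.
Proof.
by rewrite /lebesgue_unit /mrestr setTI lebesgue_measure_itv/= lte01 oppr0 adde0.
Qed.

HB.instance Definition _ := Measure_isProbability.Build _ _ R lebesgue_unit lebesgue_unitT.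

Definition haar : probability adics R := distribution lebesgue_unit digits.

(** The reals of [[0, 1[] whose [n] first digits are prescribed form an interval
of length [2 ^- n]. *)
Lemma haar_residue_class n j : 0 <= j < pow2 n -> haar (residue_class n j) = (2 ^- n)%:E.
Proof.
move=> /bitrev_bij[m /andP[m0 mn] mP].
rewrite /haar /distribution /pushforward/= /lebesgue_unit /mrestr/=.
rewrite (_ : _ `&` _ = (fun x : R => Num.floor (2 ^+ n * x)) @^-1` [set m]).
  rewrite floor_preimage lebesgue_measure_itv/= lte_fin ltr_pM2r ?invr_gt0 ?exprn_gt0//.
  rewrite ltr_int ltrDl ltr01 -EFinB -mulrBl rmorphD /= addrC addKr.
  by rewrite mul1r.
apply/seteqP; split=> x /=; rewrite in_itv /=.
  move=> [xj /andP[x0 x1]]; apply/(mP _ _).1 => //.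
  rewrite floor_ge0 mulr_ge0 ?exprn_ge0//= -(@ltr_int R).
  have /andP[+ _] := floor_itv (2 ^+ n * x) => /le_lt_trans; apply.
  by rewrite rmorphXn /= gtr_pMr ?exprn_gt0.
move=> xm; split; first by apply/(mP _ _).2; rewrite xm ?m0.
have /andP[mx xm1] := floor_itv (2 ^+ n * x); rewrite xm in mx xm1.
have p0 : 0 < 2 ^+ n :> R by rewrite exprn_gt0.
rewrite -(pmulr_rge0 _ p0) (le_trans _ mx) ?ler0z//= -(ltr_pM2l p0) mulr1.
apply: lt_le_trans xm1 _; have : m + 1 <= pow2 n by lia.
by rewrite -(ler_int R) rmorphXn.
Qed.

(** Translation permutes the residue classes modulo [2 ^ n], which all have the
same mass, and residue classes form a generating pi-system. *)
Lemma haar_translate z (A : set adics) : measurable A -> haar (translate z @^-1` A) = haar A.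
Proof.
have cover (n : nat) : residue_classes (setT : set adics) by rewrite -residue_class0; exists 0%N, 0.
apply: (@measure_unique _ _ adics residue_classes (fun=> setT) erefl
  residue_classes_setI_closed cover _
  (pushforward haar (translate z)) haar).
- exact: bigcup_const.
- move=> _ [n [j ->]]; rewrite /pushforward [X in haar X = _](translate_residue_class z n j).
  case: ifPn => jn; last by rewrite residue_class_set0// !measure0.
  by rewrite haar_residue_class ?modz_pow2_bounds//; apply: esym; exact: haar_residue_class.
- by move=> _; exact: le_lt_trans (probability_le1 haar measurableT) (ltry 1).
Qed.

(** A point lies in a residue class of mass [2 ^- n] for every [n]. *)
Lemma haar_opp_int_null (z : int) :
  haar.-negligible [set a : adics | forall n, (pow2 n %| a n + z)%Z].
Proof.
set N := [set a : adics | _].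
have NE : N = \bigcap_n residue_class n ((- z) %% pow2 n)%Z.
  apply/seteqP; split=> a Na n.
    move=> _; rewrite /residue_class /= -residue_mod.
    by apply/eqP; rewrite eqz_mod_dvd opprK; exact: Na.
  have /eqP := Na n I.
  by rewrite -[X in X == _](residue_mod a n) eqz_mod_dvd opprK.
have mN : measurable N.
  by rewrite NE; apply: bigcapT_measurable => n; exact: residue_class_measurable.
apply/negligibleP => //; apply/eqP; rewrite eq_le measure_ge0 andbT.
apply/lee_addgt0Pr => e e0; rewrite add0e.
have [n ne] : exists n, 2 ^- n <= e.
  exists (Num.bound e^-1); rewrite -[leRHS]invrK lef_pV2 ?posrE ?invr_gt0 ?exprn_gt0//.
  apply: le_trans (ltW (archi_boundP _)) _; first by rewrite invr_ge0 ltW.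
  by rewrite -natrX ler_nat ltnW// ltn_expl.
apply: (@le_trans _ _ (2 ^- n)%:E); last by rewrite lee_fin.
rewrite -(@haar_residue_class n ((- z) %% pow2 n)%Z) ?modz_pow2_bounds//.
apply: le_measure; rewrite ?inE//; first exact: residue_class_measurable.
by rewrite NE; exact: bigcap_inf.
Qed.

Lemma haar_int_null :
  haar.-negligible [set a : adics | is_integer a].
Proof.
(* The integers [z] are enumerated through [pickle]. *)
apply: negligibleS (negligible_bigcup
  (fun k => haar_opp_int_null (odflt 0 (unpickle k)))) => a [z az].
by exists (pickle z) => //=; rewrite pickleK.
Qed.

End Haar.

(** * The random field *)

Section Field.
Variable R : realType.
Implicit Types (phi : nat -> Z2 -> R) (p : adics * adics) (x z : Z2).

(** Coordinates of [p + x], to the precision that the [n]-th level requires. *)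
Definition position p x n : Z2 := (p.1 n.+1 + x.1, p.2 n.+1 + x.2).

(** The sum over all levels, set to 0 when it diverges: the field has to be
defined everywhere, and this form makes its measurability immediate. *)
Definition flux phi p x : R := fine (\sum_(n <oo) (phi n (position p x n))%:E)%E.

Lemma flux_finite phi p x N :
  (forall n, (N <= n)%N -> phi n (position p x n) = 0) ->
  flux phi p x = \sum_(n < N) phi n (position p x n).
Proof.
move=> phi0; rewrite /flux (@lim_near_cst _ _ _ _ _ (\sum_(n < N) phi n (position p x n))%:E)//.
exists N => // M /= NM; rewrite sumEFin big_mkord; congr EFin.
rewrite -(subnKC NM) big_split_ord /= [X in _ + X]big1 ?addr0// => i _.
by rewrite phi0// leq_addr.
Qed.

Lemma measurable_flux phi x : (forall n a, 0 <= phi n a) ->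
  measurable_fun [set: adics * adics] (fun p => flux phi p x).
Proof.
move=> phi0; pose S p : \bar R := (\sum_(n <oo) (phi n (position p x n))%:E)%E.
suff mS : measurable_fun setT S.
  exact: measurableT_comp (fine_measurable measurableT) mS.
apply: ge0_emeasurable_sum => [n p _ _|n _]; first by rewrite lee_fin.
apply/measurable_EFinP => _ B _; rewrite setTI.
apply: (@measurable_countable_preimage _ _ _
  (fun p : adics * adics => position p x n) [set a | B (phi n a)]) => -[i j].
rewrite (_ : _ @^-1` _ = residue_class n.+1 (i - x.1) `*` residue_class n.+1 (j - x.2)).
  by apply: measurableX; exact: residue_class_measurable.
apply/seteqP; split=> [[a b] [<- <-]|[a b] [/= ai bj]].
  by rewrite !addrK.
by rewrite /position /= ai bj !subrK.
Qed.

Definition translate2 z p : adics * adics := (translate z.1 p.1, translate z.2 p.2).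

Lemma flux_translate phi p x z : periodic phi ->
  flux phi (translate2 z p) x = flux phi p (x + z).
Proof.
move=> per; rewrite /flux; congr fine; apply: eq_eseriesr => n _; congr EFin.
by apply: per; rewrite /= modzDml addrAC addrA.
Qed.

(** Flow from [x] to [y], nonzero only if [y] is the west or the south
neighbour of [x]. *)
Definition outflow p x y : R :=
  flux (@west R) p x *+ (x == y + (1, 0)) + flux (@south R) p x *+ (x == y + (0, 1)).

Fact current_rev p e :
  outflow p (tail (erev e)) (Defs.head (erev e)) - outflow p (Defs.head (erev e)) (tail (erev e))
  = - (outflow p (tail e) (Defs.head e) - outflow p (Defs.head e) (tail e)).
Proof. by rewrite opprB. Qed.

Definition current p : vfields R := VField (current_rev p).

Lemma measurable_outflow x y : measurable_fun [set: adics * adics] (fun p => outflow p x y).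
Proof.
apply: measurable_funD.
  by case: (x == _) => //; apply: measurable_flux; exact: west_ge0.
by case: (x == _) => //; apply: measurable_flux; exact: south_ge0.
Qed.

Lemma measurable_current : measurable_fun [set: adics * adics] current.
Proof.
apply: (@measurability _ _ _ (vfields R) _ _ (@cylinders R)) => //.
move=> _ [_ [e _ [B mB <-]] <-].
rewrite setTI [X in measurable X](_ : _ =
   (fun p => outflow p (tail e) (Defs.head e) - outflow p (Defs.head e) (tail e)) @^-1` B).
  rewrite -[X in measurable X]setTI.
  by apply: measurable_funB => //; exact: measurable_outflow.
by apply/seteqP; split=> p //= [].
Qed.

HB.instance Definition _ := isMeasurableFun.Build _ _ _ _ current measurable_current.

Lemma outflow_translate z p x y :
  outflow (translate2 z p) x y = outflow p (x + z) (y + z).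
Proof.
rewrite /outflow !flux_translate; [|exact: south_periodic|exact: west_periodic].
by rewrite ![y + z + _]addrAC !(inj_eq (addIr z)).
Qed.

Lemma vfield_ext (v w : vfield R) : (forall e, v e = w e) -> v = w.
Proof.
case: v w => [v vr] [w wr] /= vw.
have {vw}vw : v = w by exact/funext.
by subst w; congr VField; exact: Prop_irrelevance.
Qed.

(** The flow out of [x] is a function of [p + x]. *)
Lemma vshift_current z p : vshift z (current p) = current (translate2 z p).
Proof. by apply: vfield_ext => e /=; rewrite !outflow_translate. Qed.

Definition haar2 : probability (adics * adics)%type R := (haar R \x haar R)%E.

Lemma measurable_translate2 z : measurable_fun [set: adics * adics] (translate2 z).
Proof.
by apply: measurable_fun_pair; apply: measurableT_comp => //; exact: measurable_translate.
Qed.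

HB.instance Definition _ z :=
  isMeasurableFun.Build _ _ _ _ (translate2 z) (measurable_translate2 z).

(** A measure on a product is determined by the masses of rectangles, to whose
sides [haar_translate] applies. *)
Lemma haar2_translate z (A : set (adics * adics)) : measurable A ->
  haar2 (translate2 z @^-1` A) = haar2 A.
Proof.
move=> mA; apply: esym.
apply: (@product_measure_unique _ _ _ _ R (haar R) (haar R) (pushforward haar2 (translate2 z))) => //.
move=> B C mB mC.
rewrite -[LHS]/(haar2 ((translate z.1 @^-1` B) `*` (translate z.2 @^-1` C))).
have mtr y (D : set adics) : measurable D -> measurable (translate y @^-1` D).
  by move=> mD; rewrite -[X in measurable X]setTI; exact: measurable_translate.
rewrite [LHS]product_measure1E; [|exact: mtr|exact: mtr].
by congr (_ * _)%E; exact: haar_translate.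
Qed.

Lemma position_corner p x n :
  corner n (position p x n) = corner n (p.1 n + x.1, p.2 n + x.2).
Proof. by rewrite /corner /= !dvdz_residueS. Qed.

Lemma div_currentE p x : div (current p) x =
  flux (@west R) p x - flux (@west R) p (x + (1, 0)) +
  (flux (@south R) p x - flux (@south R) p (x + (0, 1))).
Proof.
have loop s t : (x == x + s + t) = (s + t == 0).
  by rewrite -addrA -[X in X == _]addr0 (inj_eq (addrI x)) eq_sym.
rewrite divE /= /outflow /tail /Defs.head /= !loop !(inj_eq (addrI x)) /=.
rewrite !mulr1n !mulr0n; ring.
Qed.

(** Beyond some level [x] lies neither in the bottom row nor in the left column
of a square, so at the edges around [x] the sums are finite and [level_div] telescopes. *)
Lemma div_current p x : ~ is_integer p.1 -> ~ is_integer p.2 ->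
  div (current p) x = 1.
Proof.
move=> /not_integer_eventually e1 /not_integer_eventually e2.
have [N1 h1] := e1 x.1; have [N2 h2] := e2 x.2.
pose N := maxn N1 N2.
pose F phi y := \sum_(n < N) phi n (position p y n) : R.
have west0 y : y.2 = x.2 -> flux (@west R) p y = F (@west R) y.
  move=> yx; apply: flux_finite => n; rewrite geq_max => /andP[_ /h2 hn].
  by rewrite /west /= dvdz_residueS yx (negbTE hn) andbF.
have south0 y : y.1 = x.1 -> flux (@south R) p y = F (@south R) y.
  move=> yx; apply: flux_finite => n; rewrite geq_max => /andP[/leqW /h1 hn _].
  by rewrite /south /= yx (negbTE hn).
rewrite div_currentE (west0 x)// (west0 (x + (1, 0)))/= ?addr0//.
rewrite (south0 x)// (south0 (x + (0, 1)))/= ?addr0//.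
(* The mass gathered at [x] before the [n]-th level acts. *)
pose c n : R := 4 ^+ n *+ corner n (p.1 n + x.1, p.2 n + x.2).
have -> : F (@west R) x - F (@west R) (x + (1, 0)) +
    (F (@south R) x - F (@south R) (x + (0, 1))) = \sum_(n < N) - (c n.+1 - c n).
  rewrite /F -!sumrB -big_split; apply: eq_bigr => n _ /=.
  have shift s : position p (x + s) n = position p x n + s.
    by rewrite /position [RHS]/= !addrA.
  by rewrite !shift level_div position_corner opprB.
rewrite sumrN -(big_mkord xpredT (fun n => c n.+1 - c n)) telescope_sumr// opprB.
rewrite /c /corner /= expr0 !dvd1z /= mulr1n (negbTE (h1 N _)) ?leq_maxl//.
by rewrite mulr0n subr0.
Qed.

Lemma ae_not_integer : {ae haar2, forall p, ~ is_integer p.1 /\ ~ is_integer p.2}.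
Proof.
have [N [mN N0 sN]] := haar_int_null R.
have mN1 : measurable (N `*` [set: adics]) by exact: measurableX.
have mN2 : measurable ([set: adics] `*` N) by exact: measurableX.
have PN1 : haar2 (N `*` [set: adics]) = 0%E.
  by transitivity (haar R N * haar R setT)%E; [exact: product_measure1E|rewrite N0 mul0e].
have PN2 : haar2 ([set: adics] `*` N) = 0%E.
  by transitivity (haar R setT * haar R N)%E; [exact: product_measure1E|rewrite N0 mule0].
have n12 : haar2.-negligible (N `*` [set: adics] `|` [set: adics] `*` N).
  apply: negligibleU; [exists (N `*` [set: adics])|exists ([set: adics] `*` N)];
    by split; [|exact: PN1 || exact: PN2|].
by apply: negligibleS n12 => p /= /not_andP[] /contrapT h; [left|right]; split=> //; exact: sN.
Qed.

End Field.

Theorem theorem1 (R : realType) :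
  exists (d : measure_display) (Omega : measurableType d)
         (P : probability Omega R) (v : {RV P >-> vfields R}),
    stationary P v /\
    {ae P, forall omega, forall x : Z2, div (v omega) x = 1}.
Proof.
exists _, _, (haar2 R), (@current R); split.
  move=> z A mA; rewrite /distribution /= /pushforward /=.
  rewrite -[RHS](@haar2_translate R z); last first.
    by rewrite -[X in measurable X]setTI; exact: measurable_current.
  by congr (haar2 R _); apply/seteqP; split=> p /=; rewrite vshift_current.
apply: filterS (ae_not_integer R) => p [p1 p2] x; exact: div_current.
Qed.
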